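(* For any positive integer $m$, the following three identities hold: $$2P_{2m}P_{4m}=Q_{2m}(Q_{4m}-1),$$ $$(2m-1)F_{2m+1}+(2m+1)F_{2m-1}+F_{2m}=\frac{10mF_{4m}F_{2m}}{L_{4m}-2},$$ $$(2m-1)F_{2m}F_{2m+1}+(2m+1)F_{2m-1}F_{2m}+F_{2m}^{2}=2mF_{4m}.$$
   Context: $F_n$ and $L_n$ are the Fibonacci and Lucas numbers: $F_0=0$, $F_1=1$, $F_n=F_{n-1}+F_{n-2}$ and $L_0=2$, $L_1=1$, $L_n=L_{n-1}+L_{n-2}$ for $n\ge 2$. The Fibonacci and Lucas polynomials are defined by $F_0(x)=0$, $F_1(x)=1$, $F_n(x)=xF_{n-1}(x)+F_{n-2}(x)$ and $L_0(x)=2$, $L_1(x)=x$, $L_n(x)=xL_{n-1}(x)+L_{n-2}(x)$ for $n\ge 2$. The Pell numbers are $P_n=F_n(2)$ and the Pell-Lucas numbers are $Q_n=\frac12 L_n(2)$ (note the factor $\frac12$). *)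

(* Defs.v *)
From HB Require Import structures.
From mathcomp Require Import all_boot all_order all_algebra.

Set Implicit Arguments.
Unset Strict Implicit.
Unset Printing Implicit Defensive.

Import GRing.Theory.
Local Open Scope ring_scope.

Fixpoint fib (n : nat) : nat :=
  match n with
  | 0 => 0
  | 1 => 1
  | (n'.+1 as m).+1 => fib m + fib n'
  end%N.

Fixpoint lucas (n : nat) : nat :=
  match n with
  | 0 => 2
  | 1 => 1
  | (n'.+1 as m).+1 => lucas m + lucas n'
  end%N.

Fixpoint fib_poly (n : nat) : {poly int} :=
  match n with
  | 0%N => 0
  | 1%N => 1
  | (n'.+1 as m).+1 => 'X * fib_poly m + fib_poly n'
  end.

Fixpoint lucas_poly (n : nat) : {poly int} :=
  match n with
  | 0%N => 2
  | 1%N => 'X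
  | (n'.+1 as m).+1 => 'X * lucas_poly m + lucas_poly n'
  end.

Definition pell (n : nat) : int := (fib_poly n).[2].

(* The factor 1/2 is taken in [rat]: these are 1, 1, 3, 7, 17, ..., half of the
   companion Pell numbers in the other common normalization. *)
Definition pell_lucas (n : nat) : rat := 2^-1 * ((lucas_poly n).[2])%:~R.

(* Main.v *)
(* If u and v are the Fibonacci and Lucas polynomials at x, then
   u_(2n) = u_n v_n and, for n even, v_(2n) - 2 = (x^2 + 4) u_n^2.
   The first identity is the case x = 2. For the others take x = 1: the left
   hand side of the second identity collapses to 2m (F_(2m+1) + F_(2m-1)) =
   2m L_(2m), and the third is F_(2m) times the second. *)
Require Import Defs.
From mathcomp Require Import all_boot all_order all_algebra.
From mathcomp Require Import ring.

Set Implicit Arguments.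
Unset Strict Implicit.
Unset Printing Implicit Defensive.

Import GRing.Theory Num.Theory.
Local Open Scope ring_scope.

Section LucasSequences.
Variables (R : comNzRingType) (x : R) (u v : nat -> R).
Hypotheses (u0 : u 0 = 0) (u1 : u 1 = 1).
Hypothesis uS : forall n, u n.+2 = x * u n.+1 + u n.
Hypotheses (v0 : v 0 = 2) (v1 : v 1 = x).
Hypothesis vS : forall n, v n.+2 = x * v n.+1 + v n.

(** The induction on [m] keeps [n] general: each step moves one unit from [m] to [n]. *)
Lemma lucas_seq_add m n : u (m + n).+1 = u m.+1 * u n.+1 + u m * u n.
Proof.
elim: m n => [|m IH] n; first by rewrite u0 u1 add0n; ring.
by rewrite addSnnS IH !uS; ring.
Qed.

(** The quadratic form a^2 - x a b - b^2 changes sign under the recurrence step (a, b) -> (x a + b,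
    a). *)
Lemma lucas_seq_cassini n :
  u n.+1 ^+ 2 - x * u n * u n.+1 - u n ^+ 2 = (-1) ^+ n.
Proof.
elim: n => [|n IH]; first by rewrite u0 u1 expr0; ring.
by rewrite [RHS]exprS -IH uS; ring.
Qed.

Lemma lucas_seqE n : v n = 2 * u n.+1 - x * u n.
Proof.
(* The recurrence has order two, so the induction carries two consecutive indices. *)
suff [] : v n = 2 * u n.+1 - x * u n /\ v n.+1 = 2 * u n.+2 - x * u n.+1 by [].
elim: n => [|n [IH1 IH2]]; first by rewrite v0 v1 uS u0 u1; split; ring.
by split=> //; rewrite vS IH1 IH2 !uS; ring.
Qed.

Lemma lucas_seq_double n : u (2 * n)%N = u n * v n.
Proof.
(* The addition formula only reaches successor indices, hence the separate case [n = 0]. *)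
rewrite lucas_seqE mul2n -addnn; case: n => [|n]; first by rewrite u0; ring.
by rewrite addnS lucas_seq_add !uS; ring.
Qed.

Lemma lucas_seq_double_even m :
  v (4 * m)%N = (x ^+ 2 + 4) * u (2 * m)%N ^+ 2 + 2.
Proof.
have -> : (4 * m = 2 * (2 * m))%N by rewrite mulnA.
have := lucas_seq_cassini (2 * m); rewrite exprM sqrrN expr1n expr1n.
move: (2 * m)%N => n cassini.
rewrite lucas_seqE lucas_seq_double lucas_seqE mul2n -addnn lucas_seq_add.
(* At an even index the Cassini form equals 1; putting it in place of 1 leaves a polynomial identity
   in [x], [u n] and [u n.+1]. *)
by rewrite -[X in _ = _ + X]mulr1 -cassini; ring.
Qed.

End LucasSequences.

Lemma fib_gt0 n : (0 < n)%N -> (0 < fib n)%N.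
Proof.
case: n => // n _; elim: n => // n IH.
exact: leq_trans IH (leq_addr _ _).
Qed.

Lemma fibSS n : fib n.+2 = (fib n.+1 + fib n)%N.
Proof. by []. Qed.

(** The factor 1 is kept so that the statement matches [uS] at x = 1. *)
Lemma natr_fibS n : (fib n.+2)%:R = 1 * (fib n.+1)%:R + (fib n)%:R :> rat.
Proof. by rewrite mul1r -natrD. Qed.

Lemma natr_lucasS n :
  (lucas n.+2)%:R = 1 * (lucas n.+1)%:R + (lucas n)%:R :> rat.
Proof. by rewrite mul1r -natrD. Qed.

Lemma natr_fib_double n :
  (fib (2 * n))%:R = (fib n)%:R * (lucas n)%:R :> rat.
Proof.
exact: (lucas_seq_double (R := rat) (u := fun k => (fib k)%:R) (v := fun k => (lucas k)%:R)
  erefl erefl natr_fibS erefl erefl natr_lucasS).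
Qed.

Lemma natr_lucas_fib n : (lucas n)%:R = 2 * (fib n.+1)%:R - (fib n)%:R :> rat.
Proof.
rewrite -[(fib n)%:R]mul1r.
exact: (lucas_seqE (R := rat) (u := fun k => (fib k)%:R) (v := fun k => (lucas k)%:R)
  erefl erefl natr_fibS erefl erefl natr_lucasS).
Qed.

Lemma natr_lucas_double_even m :
  (lucas (4 * m))%:R = 5 * (fib (2 * m))%:R ^+ 2 + 2 :> rat.
Proof.
rewrite (lucas_seq_double_even (R := rat) (u := fun k => (fib k)%:R)
  (v := fun k => (lucas k)%:R) erefl erefl natr_fibS erefl erefl natr_lucasS).
by ring.
Qed.

Lemma pell0 : pell 0 = 0.
Proof. exact: horner0. Qed.

Lemma pell1 : pell 1 = 1.
Proof. exact: hornerC. Qed.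

Lemma pellS n : pell n.+2 = 2 * pell n.+1 + pell n.
Proof. by rewrite /pell /= !hornerE. Qed.

Lemma lucas_poly0_2 : (lucas_poly 0).[2] = 2.
Proof. by rewrite /= -polyC_natr hornerC. Qed.

Lemma lucas_poly1_2 : (lucas_poly 1).[2] = 2.
Proof. exact: hornerX. Qed.

Lemma lucas_polyS_2 n :
  (lucas_poly n.+2).[2] = 2 * (lucas_poly n.+1).[2] + (lucas_poly n).[2].
Proof. by rewrite /= !hornerE. Qed.

(** The factor 2 appears because the Lucas polynomial at 2 is twice [pell_lucas]. *)
Lemma pell_double n :
  (pell (2 * n))%:~R = 2 * (pell n)%:~R * pell_lucas n :> rat.
Proof.
rewrite (lucas_seq_double (v := fun k => (lucas_poly k).[2]) pell0 pell1 pellS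
  lucas_poly0_2 lucas_poly1_2 lucas_polyS_2).
by rewrite /pell_lucas intrM; field.
Qed.

Lemma pell_lucas_double_even m :
  pell_lucas (4 * m) = 4 * (pell (2 * m))%:~R ^+ 2 + 1.
Proof.
rewrite /pell_lucas (lucas_seq_double_even (v := fun k => (lucas_poly k).[2])
  pell0 pell1 pellS lucas_poly0_2 lucas_poly1_2 lucas_polyS_2).
by rewrite intrD intrM rmorphXn /=; field.
Qed.

Theorem corollary5p4 (m : nat) (m_gt0 : (0 < m)%N) :
  [/\ 2 * (pell (2 * m)%N)%:~R * (pell (4 * m)%N)%:~R
        = pell_lucas (2 * m)%N * (pell_lucas (4 * m)%N - 1) :> rat,
      (2 * m%:R - 1) * (fib (2 * m + 1)%N)%:R
        + (2 * m%:R + 1) * (fib (2 * m - 1)%N)%:R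
        + (fib (2 * m)%N)%:R
        = 10 * m%:R * (fib (4 * m)%N)%:R * (fib (2 * m)%N)%:R
          / ((lucas (4 * m)%N)%:R - 2) :> rat
    & (2 * m%:R - 1) * (fib (2 * m)%N)%:R * (fib (2 * m + 1)%N)%:R
        + (2 * m%:R + 1) * (fib (2 * m - 1)%N)%:R * (fib (2 * m)%N)%:R
        + (fib (2 * m)%N)%:R ^+ 2
        = 2 * m%:R * (fib (4 * m)%N)%:R :> rat].
Proof.
have F_neq0 : (fib (2 * m))%:R != 0 :> rat.
  by rewrite pnatr_eq0 -lt0n fib_gt0 // muln_gt0.
have four_m : (4 * m = 2 * (2 * m))%N by rewrite mulnA.
(* Positivity of [m] matters here: at [m = 0] the truncated [2 * m - 1] would be 0 and the
   recurrence would fail. With [FS] and [LE], everything is expressed through F_(2m) and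
   F_(2m-1). *)
have FS : (fib (2 * m + 1))%:R
    = (fib (2 * m))%:R + (fib (2 * m - 1))%:R :> rat.
  have : (0 < 2 * m)%N by rewrite muln_gt0.
  by case: (2 * m)%N => // n _; rewrite addn1 subn1 fibSS natrD.
have LE : (lucas (2 * m))%:R
    = (fib (2 * m))%:R + 2 * (fib (2 * m - 1))%:R :> rat.
  by rewrite natr_lucas_fib -[(2 * m).+1]addn1 FS; ring.
have F4E : (fib (4 * m))%:R = (fib (2 * m))%:R * (lucas (2 * m))%:R :> rat.
  by rewrite four_m natr_fib_double.
split.
- by rewrite pell_lucas_double_even four_m (pell_double (2 * m)); ring.
- rewrite natr_lucas_double_even F4E LE FS; field.
  (* The denominator is 5 F_(2m)^2 + 2 - 2, nonzero since F_(2m) is. *)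
  by rewrite addrK !mulf_neq0.
- by rewrite F4E LE FS; ring.
Qed.
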